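(* Let $X$ be a sequentially compact topological space. If $\chi(X)<\mathfrak{b}$, then $X$ is $\omega_1$-sequentially compact.
   Context: $\chi(X)$ is the character of $X$; $\mathfrak{b}$ is the bounding number (least size of a $\leq^*$-unbounded family in $\omega^\omega$). For sets of naturals, $s\sqsubseteq t$ means $s$ is an initial segment of $t$. For $\mathcal{F}\subseteq[\omega]^{<\omega}$ and $M\subseteq\omega$ let $\mathcal{F}|M=\{s\in\mathcal{F}:s\subseteq M\}$. A barrier on an infinite set $M\subseteq\omega$ is a family $\mathcal{B}$ of finite subsets of $M$ such that (a) $s\subseteq t$ implies $s=t$ for $s,t\in\mathcal{B}$, and (b) every infinite $N\subseteq M$ has an initial segment $s\sqsubseteq N$ with $s\in\mathcal{B}$. Every barrier has a rank: $T(\mathcal{B})=\{s\in[\omega]^{<\omega}:\exists t\in\mathcal{B}\,(s\sqsubseteq t)\}$, $\rho_{T(\mathcal{B})}(s)=\sup\{\rho_{T(\mathcal{B})}(t)+1:t\in T(\mathcal{B}),\ s\sqsubseteq t,\ s\neq t\}$ (with $\sup\emptyset=0$), and $\rho(\mathcal{B})=\rho_{T(\mathcal{B})}(\emptyset)<\omega_1$. If $\mathcal{B}$ is a barrier on an infinite set $M$, $f:\mathcal{B}\to X$ converges to $x\in X$ if for every open $U\ni x$ there is $n\in\omega$ with $f[\mathcal{B}|(M\setminus n)]\subseteq U$. For a barrier $\mathcal{B}$ on $\omega$, $X$ is $\mathcal{B}$-sequentially compact if for every $f:\mathcal{B}\to X$ there is an infinite $M\subseteq\omega$ such that $f\restriction(\mathcal{B}|M)$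 converges to some point of $X$. For $\alpha<\omega_1$, $X$ is $\alpha$-sequentially compact if it is $\mathcal{B}$-sequentially compact for all barriers $\mathcal{B}$ on $\omega$ of rank $\alpha$; $X$ is $\omega_1$-sequentially compact if it is $\alpha$-sequentially compact for every $\alpha<\omega_1$. *)

(* Defs.v *)
From mathcomp Require Import all_boot all_order.
From mathcomp Require Import boolp classical_sets functions cardinality topology.

Set Implicit Arguments.
Unset Strict Implicit.
Unset Printing Implicit Defensive.

Local Open Scope classical_set_scope.
Local Open Scope card_scope.

(* A cardinal number is given by a representative: a set (of any type), taken
   up to equinumerosity [#=]. *)

Definition card_lt (T U : Type) (A : set T) (B : set U) : Prop :=
  (A #<= B) /\ ~ (B #<= A).

Definition local_base (X : topologicalType) (x : X) (B : set (set X)) : Prop :=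
  (forall U, B U -> open U /\ U x) /\
  (forall V, open V -> V x -> exists2 U, B U & U `<=` V).

(* kappa represents chi(x, X). *)
Definition is_point_character (X : topologicalType) (x : X) (T : Type)
    (kappa : set T) : Prop :=
  (exists2 B, local_base x B & B #= kappa) /\
  (forall B, local_base x B -> kappa #<= B).

(* kappa represents chi(X), the supremum over x of chi(x, X). A point character
   is the cardinality of a local base, so representatives in [set X] suffice. *)
Definition is_character (X : topologicalType) (T : Type) (kappa : set T) :
    Prop :=
  (forall (x : X) (lambda : set (set X)),
     is_point_character x lambda -> lambda #<= kappa) /\
  (forall (U : Type) (mu : set U),
     (forall (x : X) (lambda : set (set X)),
        is_point_character x lambda -> lambda #<= mu) ->
     kappa #<= mu).

Definition eventually_le (f g : nat -> nat) : Prop :=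
  \forall n \near \oo, f n <= g n.

Definition eventually_unbounded (F : set (nat -> nat)) : Prop :=
  ~ exists g, forall f, F f -> eventually_le f g.

Definition is_bounding_number (T : Type) (b : set T) : Prop :=
  (exists2 F, eventually_unbounded F & F #= b) /\
  (forall F, eventually_unbounded F -> b #<= F).

(* Countable ordinals: [OSup f] denotes sup_n (f n + 1). Every ordinal below
   omega_1 is denoted by some term, and two terms denote the same ordinal
   exactly when they are related by [oeq]. *)
Inductive cord : Type :=
| OZero : cord
| OSup : (nat -> cord) -> cord.

Fixpoint ole (a b : cord) : Prop :=
  match a with
  | OZero => True
  | OSup f => forall n,
      match b with
      | OZero => False
      | OSup g => exists m, ole (f n) (g m)
      end
  end.

Definition oeq (a b : cord) : Prop := ole a b /\ ole b a.

Definition osucc (a : cord) : cord := OSup (fun=> a).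

Definition is_osup (S : set cord) (a : cord) : Prop :=
  forall b, ole a b <-> (forall c, S c -> ole c b).

Definition initial_segment (s t : set nat) : Prop :=
  s `<=` t /\ (forall m n, s n -> t m -> m <= n -> s m).

Definition restr (F : set (set nat)) (M : set nat) : set (set nat) :=
  [set s | F s /\ s `<=` M].

Definition is_barrier (M : set nat) (B : set (set nat)) : Prop :=
  [/\ infinite_set M,
      forall s, B s -> finite_set s /\ s `<=` M,
      forall s t, B s -> B t -> s `<=` t -> s = t &
      forall N, infinite_set N -> N `<=` M ->
        exists2 s, B s & initial_segment s N].

Definition barrier_tree (B : set (set nat)) : set (set nat) :=
  [set s | finite_set s /\ exists2 t, B t & initial_segment s t].

(* Only the values of rho on the members of the tree T matter. *)
Definition is_rank_function (T : set (set nat)) (rho : set nat -> cord) :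
    Prop :=
  forall s, T s ->
    is_osup [set osucc (rho t) | t in
               [set t | [/\ T t, initial_segment s t & s <> t]]]
            (rho s).

Definition has_rank (B : set (set nat)) (alpha : cord) : Prop :=
  exists2 rho, is_rank_function (barrier_tree B) rho & oeq (rho set0) alpha.

(* A map B -> X is given as a total map on [set nat], of which only the
   restriction to B is used; nothing is lost, since B is nonempty and so a map
   B -> X extends. *)
Definition barrier_cvg (X : topologicalType) (M : set nat) (B : set (set nat))
    (f : set nat -> X) (x : X) : Prop :=
  forall U, open U -> U x ->
    exists n, f @` restr B (M `\` `I_n) `<=` U.

Definition barrier_sequentially_compact (X : topologicalType)
    (B : set (set nat)) : Prop :=
  forall f : set nat -> X,
    exists2 M, infinite_set M & exists x, barrier_cvg M (restr B M) f x.

Definition ord_sequentially_compact (X : topologicalType) (alpha : cord) :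
    Prop :=
  forall B, is_barrier setT B -> has_rank B alpha ->
    barrier_sequentially_compact X B.

Definition omega1_sequentially_compact (X : topologicalType) : Prop :=
  forall alpha : cord, ord_sequentially_compact X alpha.

Definition sequentially_compact (X : topologicalType) : Prop :=
  forall u : nat -> X,
    exists2 phi : nat -> nat, {homo phi : m n / m < n} &
      exists x : X, u \o phi @ \oo --> x.

(* Main.v *)
Require Import Defs.
From mathcomp Require Import all_boot all_order.
From mathcomp Require Import boolp classical_sets functions cardinality topology.

(** For a finite set [s], let the cone of [s] be the set of members of the
    barrier that end-extend [s]. By bar recursion along the barrier, it is
    enough to pass from the one-point extensions [s u {m}] to [s]: a failure
    at the empty set would propagate along an infinite set with no initial
    segment in the barrier. In the inductive step, fusion yields points
    [m_0 < m_1 < ...] and limits [x_k] of the cones of [s u {m_k}] along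
    decreasing infinite sets; sequential compactness gives a subsequence of
    [x_k] tending to some [x]. Each basic neighbourhood of [x] has a modulus
    [k |-> n] telling where the cone of [s u {m_k}] enters it; there are fewer
    than b of them, so a single [g] eventually dominates all, and thinning out
    the [m_k] faster than [g] makes the whole cone of [s] converge to [x]. *)

Set Implicit Arguments.
Unset Strict Implicit.
Unset Printing Implicit Defensive.

Local Open Scope classical_set_scope.
Local Open Scope card_scope.

(** * Bounded and infinite sets of naturals *)

Lemma finite_set_nat_bounded (A : set nat) :
  finite_set A <-> exists n, A `<=` `I_n.
Proof.
split=> [/finite_seqP[s ->]|[n An]]; last exact: sub_finite_set An (finite_II n).
exists (\max_(i <- s) i).+1 => i /= si.
by rewrite ltnS; exact: leq_bigmax_seq.
Qed.

Lemma infinite_set_nat_unbounded (A : set nat) :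
  infinite_set A <-> forall n, exists2 m, A m & n <= m.
Proof.
split=> [Ainf n|Aunb /finite_set_nat_bounded[n An]]; last first.
  by have [m /An /=] := Aunb n; rewrite ltnNge => /negP.
apply: contrapT => nA; apply/Ainf/finite_set_nat_bounded.
exists n => m Am /=; rewrite ltnNge; apply/negP => nm; apply: nA.
by exists m.
Qed.

(** * Local bases, characters and the bounding number *)

(* Well-foundedness of cardinals. A maximal set of choice functions for [P]
   with pairwise distinct values at every member of [P] must exhaust some
   member of [P] (otherwise a further function could be added), and that member
   then injects into all the others. *)
Lemma card_le_minimal (V : Type) (P : set (set V)) :
  P !=set0 -> exists2 A, P A & forall B, P B -> A #<= B.
Proof.
move=> [A0 PA0].
pose Q := [set S : set (set V -> V) |
  (forall h B, S h -> P B -> B (h B)) /\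
  (forall h k B, S h -> S k -> P B -> h B = k B -> h = k)].
have [F FQ Ftot|S [[Smem Sinj] Smax]] := @Zorn_bigcup _ Q.
  split=> [h B [S FS Sh] PB|h k B [S FS Sh] [S' FS' S'k] PB].
    by have [FSmem _] := FQ _ FS; exact: (FSmem h B).
  have [SS'|S'S] := Ftot _ _ FS FS'.
    by have [_ inj] := FQ _ FS'; apply: inj => //; exact: SS'.
  by have [_ inj] := FQ _ FS; apply: inj => //; exact: S'S.
have [[A PA AS]|noA] := pselect (exists2 A, P A & A `<=` [set h A | h in S]).
  exists A => // B PB.
  apply: (card_le_trans (subset_card_le AS)).
  apply: (card_le_trans (card_image_le _ _)).
  have SB : [set h B | h in S] #= S.
    apply: inj_card_eq => h k; rewrite !inE => Sh Sk.
    exact: Sinj.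
  apply: (@card_le_trans _ _ _ [set h B | h in S]).
    by have /card_eqPle[] := SB.
  by apply: subset_card_le => _ [h Sh <-]; exact: (Smem h B).
exfalso.
have fresh A : P A -> exists v, A v /\ ~ [set k A | k in S] v.
  move=> PA; apply: contrapT => nv; apply: noA; exists A => // v Av.
  by apply: contrapT => nSv; apply: nv; exists v.
have [v0 _] := fresh A0 PA0.
have /choice[h hP] (A : set V) :
    exists v : V, P A -> A v /\ ~ [set k A | k in S] v.
  by have [/fresh[v]|] := pselect (P A); [exists v|exists v0].
have nSh : ~ S h.
  by move=> Sh; have [_] := hP A0 PA0; apply; exists h.
apply: (Smax (h |` S)).
  split; first by move=> k Sk; right.
  by move=> sub; apply: nSh; apply: sub; left.
split=> [k B [->|Sk] PB|k l B [->|Sk] [->|Sl] PB e //].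
- by have [] := hP _ PB.
- exact: (Smem k B).
- by have [_ []] := hP _ PB; exists l.
- by have [_ []] := hP _ PB; exists k.
- exact: Sinj e.
Qed.

(** A local base of least cardinality realises the point character at [x], which [chi] bounds. *)
Lemma local_base_card_le_character (X : topologicalType) (T : Type)
    (chi : set T) (x : X) :
  is_character X chi -> exists2 B, local_base x B & B #<= chi.
Proof.
move=> [chiP _].
have [|B Bx Bmin] := @card_le_minimal _ [set B | local_base x B].
  exists [set V | open V /\ V x]; split=> // V oV Vx.
  by exists V.
by exists B => //; apply: (chiP x); split=> //; exists B.
Qed.

Lemma eventually_bounded_card_lt (T U : Type) (a : set T) (b : set U)
    (F : set (nat -> nat)) :
  is_bounding_number b -> card_lt a b -> F #<= a ->
  exists g, forall f, F f -> eventually_le f g.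
Proof.
move=> [_ bmin] [_ nba] Fa; apply: contrapT => Funb.
by apply: nba; apply: card_le_trans Fa; exact: bmin.
Qed.

(** * End-extensions and fusion *)

(** Used to place a proper end-extension of [s] in the cone of a one-point extension of [s]. *)
Lemma initial_segment_setU1_min (s t : set nat) :
  initial_segment s t -> s <> t ->
  exists a, [/\ (t `\` s) a, (forall i, (t `\` s) i -> a <= i) &
                initial_segment (a |` s) t].
Proof.
move=> [st sseg] neq_st.
have ex : exists i, `[< (t `\` s) i >].
  apply: contrapT => no; apply: neq_st; apply/seteqP; split=> // i ti.
  by apply: contrapT => nsi; apply: no; exists i; apply/asboolP.
have /asboolP ats := ex_minnP ex.
case: (ex_minnP ex) => a /asboolP [ta nsa] amin.
have {}amin i : (t `\` s) i -> a <= i by move=> tsi; apply/amin/asboolP.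
exists a; split=> //; split=> [i [->//|/st//]|m n [->|sn] tm mn]; last first.
  by right; exact: sseg sn tm mn.
have [sm|nsm] := pselect (s m); first by right.
by left; apply/eqP; rewrite eqn_leq mn; apply: amin.
Qed.

Section Fusion.
Variables (X : Type) (R : nat -> set nat -> X -> Prop) (l : nat).
Hypothesis R_refine : forall m M, l <= m -> infinite_set M ->
  exists N x, [/\ infinite_set N, N `<=` M & R m N x].

Lemma fusion_sequence (M : set nat) : infinite_set M ->
  exists (m : nat -> nat) (N : nat -> set nat) (x : nat -> X),
    [/\ {homo m : i j / i < j}, forall k, M (m k) /\ l <= m k,
        forall k, R (m k) (N k) (x k) & forall i j, i < j -> N i (m j)].
Proof.
move=> Minf.
have [_ [x0 _]] := R_refine (leqnn l) Minf.
have /choice[next nextP] (p : nat * set nat) : exists q : set nat * X,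
    l <= p.1 -> infinite_set p.2 ->
    [/\ infinite_set q.1, q.1 `<=` p.2 & R p.1 q.1 q.2].
  have [[lp Ainf]|np] := pselect (l <= p.1 /\ infinite_set p.2).
    by have [N [x Nx]] := R_refine lp Ainf; exists (N, x).
  by exists (set0, x0) => lp Ainf; case: np.
have /choice[elt eltP] (p : nat * set nat) : exists m : nat,
    infinite_set p.2 -> p.2 m /\ p.1 <= m.
  have [/infinite_set_nat_unbounded/(_ p.1)[m ? ?]|np] :=
    pselect (infinite_set p.2); first by exists m.
  by exists 0.
pose step p := let m := elt p in (m.+1, (next (m, p.2)).1).
pose st k := iter k step (l, M).
pose m k := elt (st k).
have stP k : l <= (st k).1 /\ infinite_set (st k).2.
  elim: k => [|k [lk infk]] //=; have [mk lmk] := eltP _ infk.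
  have lm : l <= elt (st k) := leq_trans lk lmk.
  have [? _ _] := nextP (elt (st k), (st k).2) lm infk.
  by split=> //; exact: leqW.
have mP k : (st k).2 (m k) /\ (st k).1 <= m k by exact: eltP (stP k).2.
have lm k : l <= m k by exact: leq_trans (stP k).1 (mP k).2.
have nP k := nextP (m k, (st k).2) (lm k) (stP k).2.
have st_decr : {homo (fun k => (st k).2) : i j / i <= j >-> j `<=` i}.
  apply: homo_leq => [A|A B C BA CB|k]; [exact: subset_refl| |].
    exact: subset_trans CB BA.
  by have [] := nP k.
(* The set of stage [k.+1] is the refinement made for [m k]; as the sets decrease, it contains every
   later point. *)
exists m, (fun k => (st k.+1).2), (fun k => (next (m k, (st k).2)).2).
split=> [|k|k|i j ij].
- by apply: homo_ltn => [? ? ?|k]; [exact: ltn_trans|exact: (mP k.+1).2].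
- by split=> //; exact: st_decr (leq0n k) _ (mP k).1.
- by have [] := nP k.
- exact: st_decr ij _ (mP j).1.
Qed.

End Fusion.

(** * Convergence on cones of a barrier *)

Section Cones.
Variables (X : topologicalType) (B : set (set nat)) (f : set nat -> X).

(** [N] and [n] constrain only the points added to [s], because [s] itself need not lie in the set
    being thinned. *)
Definition cone_cvg (s N : set nat) (x : X) : Prop :=
  forall U, open U -> U x -> exists n, forall t, B t -> initial_segment s t ->
    t `\` s `<=` N -> (forall i, (t `\` s) i -> n <= i) -> U (f t).

Definition cone_cvg_subset (s : set nat) : Prop :=
  forall M, infinite_set M ->
    exists N x, [/\ infinite_set N, N `<=` M & cone_cvg s N x].

Hypothesis B_antichain : forall s t, B s -> B t -> s `<=` t -> s = t.

(** By the antichain condition [s0] is the only possible member of the cone of [s], so [f s0] serves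
    as the limit. *)
Lemma cone_cvg_subset_above (s0 s : set nat) :
  B s0 -> s0 `<=` s -> cone_cvg_subset s.
Proof.
move=> Bs0 s0s M Minf; exists M, (f s0); split=> // U _ Ux.
exists 0 => t Bt [st _] _ _.
by rewrite -(B_antichain Bs0 Bt (subset_trans s0s st)).
Qed.

Variables (T : Type) (chi : set T) (U : Type) (b : set U).
Hypotheses (X_sc : sequentially_compact X) (chiP : is_character X chi).
Hypotheses (bP : is_bounding_number b) (chi_lt_b : card_lt chi b).

Lemma cone_cvg_subset_step (s : set nat) (l : nat) :
  (forall m, l <= m -> cone_cvg_subset (m |` s)) -> cone_cvg_subset s.
Proof.
(* The case [B s] is split off because [t = s] has no first added point. *)
move=> Ps; have [Bs|nBs] := pselect (B s).
  exact: cone_cvg_subset_above Bs (@subset_refl _ _).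
move=> M /(fusion_sequence (R := fun m => cone_cvg (m |` s)) (l := l)).
case=> [m A lm|m [N [x [m_incr mM Nx Nm]]]]; first exact: Ps.
have [phi phi_incr [y xy]] := X_sc x.
have {}xy V : open V -> V y -> exists I, forall i, I <= i -> V (x (phi i)).
  by move=> oV Vy; have [I _ HI] := xy V (open_nbhs_nbhs (conj oV Vy)); exists I.
have [W [Wopen Wbase] Wchi] := local_base_card_le_character y chiP.
have /choice[modulus modulusP] (p : set X * nat) :
    exists n, open p.1 -> p.1 (x p.2) -> forall t, B t ->
      initial_segment (m p.2 |` s) t -> t `\` (m p.2 |` s) `<=` N p.2 ->
      (forall i, (t `\` (m p.2 |` s)) i -> n <= i) -> p.1 (f t).
  have [[oV Vx]|nV] := pselect (open p.1 /\ p.1 (x p.2)).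
    by have [n nP] := Nx p.2 p.1 oV Vx; exists n.
  by exists 0 => oV Vx; case: nV.
have [g gP] := eventually_bounded_card_lt bP chi_lt_b
  (card_le_trans (card_image_le (fun V k => modulus (V, k)) W) Wchi).
(* Each index passes [g] at the previous selected index; since [phi] and [m] dominate the identity,
   this gives [g (c i) <= m (c j)] for [i < j]. *)
pose i_ := fix i_ j :=
  if j is j'.+1 then maxn (i_ j').+1 (g (phi (i_ j'))) else 0.
pose c j := phi (i_ j).
have i_incr : {homo i_ : i j / i < j}.
  by apply: homo_ltn => [? ? ?|j]; [exact: ltn_trans|rewrite /= leq_maxl].
have incr_ge (h : nat -> nat) : {homo h : i j / i < j} -> forall i, i <= h i.
  by move=> hi; elim=> // i /leq_ltn_trans; apply; exact: hi.
have c_incr : {homo c : i j / i < j} by move=> i j /i_incr/phi_incr.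
have mc_incr : {homo m \o c : i j / i < j} by move=> i j /c_incr/m_incr.
have mcg i j : i < j -> g (c i) <= m (c j).
  move=> ij; apply: (@leq_trans (i_ i.+1)); first by rewrite /= leq_maxr.
  apply: (@leq_trans (i_ j)).
    by rewrite (leq_mono i_incr).
  by apply: leq_trans (incr_ge _ phi_incr _) (incr_ge _ m_incr _).
exists (range (m \o c)), y; split.
- apply/infinite_set_nat_unbounded => n.
  by exists (m (c n)); [exists n|exact: incr_ge mc_incr n].
- by move=> _ [j _ <-]; have [] := mM (c j).
move=> V oV Vy; have [V' WV' V'V] := Wbase V oV Vy.
have [oV' V'y] := Wopen V' WV'.
have [I IV'] := xy V' oV' V'y.
have [K _ Kg] : eventually_le (fun k => modulus (V', k)) g by apply: gP; exists V'.
(* Beyond [I] the limits lie in [V']; beyond [K] the modulus of [V'] is below [g]. *)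
pose J := maxn I K.
exists (m (c J)) => t Bt st tN tJ; apply: V'V.
have [|a [ta amin ast]] := initial_segment_setU1_min st.
  by move=> e; apply: nBs; rewrite e.
have [j _ aE] := tN _ ta; rewrite -{a}aE /= in ta amin ast.
have Jj : J <= j.
  by rewrite -(leq_mono mc_incr); exact: tJ.
have tail i : (t `\` (m (c j) |` s)) i -> exists2 k, j < k & i = m (c k).
  move=> [ti nsi]; have tsi : (t `\` s) i by split=> // si; apply: nsi; right.
  have [k _ iE] := tN _ tsi; exists k => //.
  have := amin _ tsi; rewrite -iE /= (leq_mono mc_incr) leq_eqVlt.
  by case/predU1P => // jk; case: nsi; left; rewrite -iE jk.
apply: (modulusP (V', c j)) => //.
- apply: IV'; apply: leq_trans (incr_ge _ i_incr j).
  by apply: leq_trans Jj; exact: leq_maxl.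
- by move=> i /tail[k jk ->]; apply: Nm; exact: c_incr.
move=> i /tail[k jk ->]; apply: leq_trans (mcg _ _ jk).
apply: Kg => /=; apply: leq_trans (incr_ge _ c_incr j).
by apply: leq_trans Jj; exact: leq_maxr.
Qed.

Lemma cone_cvg_subset_set0 :
  (forall s, B s -> finite_set s) ->
  (forall N, infinite_set N -> exists2 s, B s & s `<=` N) ->
  cone_cvg_subset set0.
Proof.
move=> Bfin Bbar; apply: contrapT => nP0.
have /choice[next nextP] (p : nat * set nat) : exists m : nat,
    ~ cone_cvg_subset p.2 -> p.1 <= m /\ ~ cone_cvg_subset (m |` p.2).
  have [Ps|nPs] := pselect (cone_cvg_subset p.2); first by exists 0.
  apply: contrapT => nm; apply/nPs/(@cone_cvg_subset_step _ p.1) => m pm.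
  by apply: contrapT => nPm; apply: nm; exists m.
pose step p := ((next p).+1, next p |` p.2).
pose st k := iter k step (0, set0).
have stP k : ~ cone_cvg_subset (st k).2.
  by elim: k => //= k /nextP[].
have st_ge k : k <= (st k).1.
  elim: k => //= k; rewrite ltnS => /leq_trans; apply.
  by have [] := nextP _ (stP k).
have st_incr : {homo (fun k => (st k).2) : i j / i <= j >-> i `<=` j}.
  apply: homo_leq => [A|A C D|k]; [exact: subset_refl|exact: subset_trans|].
  by move=> i; right.
(* The failing sets increase to an infinite set, which must contain a member of the barrier. *)
have [|s Bs sN] := Bbar (\bigcup_k (st k).2).
  apply/infinite_set_nat_unbounded => n; exists (next (st n)).
    by exists n.+1 => //; left.
  by have [+ _] := nextP _ (stP n); exact: leq_trans.
have /finite_set_nat_bounded[p sp] := Bfin s Bs.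
have /choice[j jP] (i : nat) : exists j, s i -> (st j).2 i.
  have [/sN[j _ ?]|] := pselect (s i); first by exists j.
  by exists 0.
(* Being finite, [s] is already contained in one failing stage, which contradicts
   [cone_cvg_subset_above]. *)
apply: (stP (\max_(i < p) j i)); apply: (cone_cvg_subset_above Bs) => i si.
apply: st_incr (jP i si).
exact: (@leq_bigmax _ (fun i : 'I_p => j i) (Ordinal (sp i si))).
Qed.

End Cones.

Theorem theorem4p2 (X : topologicalType)
    (T : Type) (chi : set T) (U : Type) (b : set U)
    (X_sc : sequentially_compact X)
    (chiP : is_character X chi) (bP : is_bounding_number b)
    (chi_lt_b : card_lt chi b) :
  omega1_sequentially_compact X.
Proof.
move=> alpha B [setT_inf Bfin Banti Bbar] _ f.
have [|N Ninf|N [x [Ninf _ Nx]]] :=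
    @cone_cvg_subset_set0 X B f Banti T chi U b X_sc chiP bP chi_lt_b
      _ _ setT setT_inf.
- by move=> s /Bfin[].
- by have [//|s Bs [sN _]] := Bbar N Ninf; exists s.
exists N => //; exists x => V oV Vx; have [n nP] := Nx V oV Vx.
(* The cone of the empty set is the whole barrier, and every point of [t] counts as added. *)
exists n => _ [t [[Bt _] tN] <-]; apply: nP => //; rewrite ?setD0.
- by split=> // i j [].
- by move=> i /tN[].
- by move=> i /tN[_ /= nin]; rewrite leqNgt; apply/negP.
Qed.
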